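(* Let $n$ and $k$ be integers satisfying $2.5k-0.5\le n\le 7k-5$ and $k\ge 2$. Then the mutual-visibility number of the Kneser graph $KG(n,k)$ satisfies $$\mu(KG(n,k))\ge\binom{n-1}{k-1}.$$
   Context: Kneser graph: $KG(n,k)$ has as vertices the $k$-element subsets of $[n]=\{1,\dots,n\}$; two vertices $A,B$ are adjacent if and only if $A\cap B=\emptyset$. Mutual-visibility: Let $G$ be a connected graph and $\mathcal X\subseteq V(G)$. Two vertices $u,v\in V(G)$ are $\mathcal X$-visible if there is a shortest $u,v$-path $P$ in $G$ with no internal vertex in $\mathcal X$, i.e. $V(P)\cap\mathcal X\subseteq\{u,v\}$. The set $\mathcal X$ is a mutual-visibility set if any two vertices of $\mathcal X$ are $\mathcal X$-visible. The mutual-visibility number $\mu(G)$ is the largest cardinality of a mutual-visibility set in $G$. *)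

(* Defs.v *)
From mathcomp Require Import all_boot.
From mathcomp Require Import boolp.

Set Implicit Arguments.
Unset Strict Implicit.
Unset Printing Implicit Defensive.

(* A finite simple graph is given by its adjacency relation on a finType. *)
Section MutualVisibility.
Variables (T : finType) (e : rel T).
Implicit Types (u v x : T) (p q : seq T) (X : {set T}).

(* As in path.v, the path with vertices u, p_0, p_1, ... is split into its
   origin u and the tail p, so that its length is size p. *)
Definition is_upath u v p : Prop :=
  [/\ path e u p, last u p = v & uniq (u :: p)].

Definition is_shortest_path u v p : Prop :=
  is_upath u v p /\ (forall q, is_upath u v q -> size p <= size q).

Definition visible X u v : Prop :=
  exists2 p, is_shortest_path u v p &
    forall x, x \in u :: p -> x \in X -> x = u \/ x = v.

(* The pairs with u = v are harmless: the path of length 0 shows that every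
   vertex is visible from itself. *)
Definition mutual_visibility_set X : Prop :=
  forall u v, u \in X -> v \in X -> visible X u v.

Definition mutual_visibility_number : nat :=
  \max_(X : {set T} | `[< mutual_visibility_set X >]) #|X|.

End MutualVisibility.

(* The ground set {1, ..., n} is represented by 'I_n = {0, ..., n-1}. *)
Definition kneser_vertex (n k : nat) : finType :=
  {A : {set 'I_n} | #|A| == k}.

(* Irreflexive, hence a simple graph, as soon as 0 < k; connected when
   2 * k < n. *)
Definition kneser (n k : nat) : rel (kneser_vertex n k) :=
  fun A B => val A :&: val B == set0.

Arguments kneser n k : clear implicits.

(* Main.v *)
Require Import Defs.
From mathcomp Require Import all_boot.
From mathcomp Require Import boolp zify.

Set Implicit Arguments.
Unset Strict Implicit.
Unset Printing Implicit Defensive.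

(** The bound is attained by a star: the family of all k-sets containing a
    fixed point of the ground set.  A star has 'C(n - 1, k - 1) members and is
    an independent set of the Kneser graph, since its members meet pairwise.
    In any graph, an inner vertex of a path of length at most 3 is adjacent to
    one of the two ends; so, if both ends lie in an independent set, no inner
    vertex does ([independent_diameter3_mutual_visibility]).  It remains to see
    that two members A and B of the star are at distance at most 3
    ([kneser_walk3]).  When at least k points lie outside A :|: B, any k of
    them form a common neighbour.  Otherwise the lower bound on n makes
    A :&: B so small that two disjoint sets of that size fit outside A :|: B;
    one completes B :\: A to a neighbour of A, the other completes A :\: B to
    a neighbour of B, and these two neighbours are disjoint. *)

Section IndependentSets.
Variables (T : finType) (e : rel T).

(** The [shorten]ing of a walk is a path that is no longer than it, so a
    path of minimal length is no longer than any walk. *)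
Lemma walk_shortest_path (u v : T) (p : seq T) :
  path e u p -> last u p = v ->
  exists2 q, is_shortest_path e u v q & size q <= size p.
Proof.
move=> pP lp.
pose P m := `[< exists q, is_upath e u v q /\ size q = m >].
have [q [qU qs]] : exists q, is_upath e u v q /\ size q <= size p.
  move: lp; case/shortenP: pP => q qP qU /uniq_leq_size qs lq.
  exists q; split; first by split.
  by apply: qs; case/andP: qU.
have exP : exists m, P m by exists (size q); apply/asboolP; exists q.
case: (ex_minnP exP) => m /asboolP[r [rU rm]] minm.
have rmin q' : is_upath e u v q' -> size r <= size q'.
  by move=> q'U; rewrite rm; apply: minm; apply/asboolP; exists q'.
by exists r => //; apply: leq_trans qs; apply: rmin.
Qed.

(** An inner vertex of a path of length at most 3 is adjacent to one of its
    ends, hence lies outside any independent set containing both. *)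
Lemma independent_diameter3_mutual_visibility (X : {set T}) :
  {in X &, forall u v, ~~ e u v} ->
  {in X &, forall u v, exists p,
     [/\ path e u p, last u p = v & size p <= 3]} ->
  mutual_visibility_set e X.
Proof.
move=> indX walkX u v uX vX.
have [p [pP lp sp]] := walkX u v uX vX.
have [q qS sq] := walk_shortest_path pP lp.
exists q => // x; have {sp}sq := leq_trans sq sp.
case: qS => -[qP lq _] _ xq xX.
have nux : ~~ e u x by apply: indX.
have nxv : ~~ e x v by apply: indX.
move: q sq qP lq xq => [|a [|b [|c [|d q]]]] //= _; rewrite !inE.
- by move=> _ _ /eqP; left.
- by move=> _ -> /orP[] /eqP ->; [left | right].
- move=> /and3P[ua _ _] -> /or3P[] /eqP xE; [by left | | by right].
  by rewrite xE ua in nux.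
- move=> /and4P[ua _ bc _] cv; rewrite cv in bc *.
  case/or4P=> /eqP xE; [by left | | | by right].
    by rewrite xE ua in nux.
  by rewrite xE bc in nxv.
Qed.

End IndependentSets.

Lemma subset_of_card (T : finType) (S : {set T}) (m : nat) :
  m <= #|S| -> exists2 C : {set T}, C \subset S & #|C| = m.
Proof.
rewrite -bin_gt0 -cards_draws card_gt0 => /set0Pn[C].
by rewrite inE => /andP[CS /eqP Cm]; exists C.
Qed.

Section Kneser.
Variables n k : nat.

(** Put s := #|A :&: B| and r := n - 2 * k, so that r + s points lie outside
    A :|: B.  The bound on n says that k - 1 <= 2 * r.  So if r + s < k, that
    is, if no common neighbour exists, then s <= k - 1 - r <= r, and
    2 * s <= r + s leaves room for two disjoint sets C and D of size s; the
    walk is then A, (B :\: A) :|: C, (A :\: B) :|: D, B. *)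
Lemma kneser_walk3 (A B : kneser_vertex n k) :
  5 * k - 1 <= 2 * n -> val A :&: val B != set0 ->
  exists p, [/\ path (kneser n k) A p, last A p = B & size p <= 3].
Proof.
case: A B => [A /= /[dup] /eqP cA hA] [B /= /[dup] /eqP cB hB] hn AB.
pose R := ~: (A :|: B).
have cU : #|A :|: B| = k + k - #|A :&: B| by rewrite cardsU cA cB.
have cR : #|A :|: B| + #|R| = n by rewrite cardsC card_ord.
have cAB : #|A :&: B| + #|A :\: B| = k by rewrite cardsID.
have cBA : #|A :&: B| + #|B :\: A| = k by rewrite setIC cardsID.
rewrite -card_gt0 in AB.
have outR x : x \in R -> (x \notin A) && (x \notin B).
  by rewrite !inE negb_or.
case: (leqP k #|R|) => hR.
  have [C /subsetP CR cC] := subset_of_card hR.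
  have hC : #|C| == k by apply/eqP.
  exists [:: exist _ C hC; exist _ B hB]; split=> //=.
  rewrite /kneser /=; apply/and3P; split=> //; apply/eqP/setP=> x;
    have := CR x; rewrite !inE negb_or; case: (x \in C);
    by case: (x \in A); case: (x \in B) => // /(_ isT).
have [C CR cC] : exists2 C : {set 'I_n}, C \subset R & #|C| = #|A :&: B|.
  by apply: subset_of_card; lia.
have [D DR cD] : exists2 D : {set 'I_n}, D \subset R :\: C & #|D| = #|A :&: B|.
  by apply: subset_of_card; have := cardsID C R; rewrite (setIidPr CR); lia.
have {}CR x : x \in C -> (x \notin A) && (x \notin B).
  by move/(subsetP CR)/outR.
have {}DR x : x \in D -> [&& x \notin C, x \notin A & x \notin B].
  by move/(subsetP DR); rewrite inE => /andP[-> /outR].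
have hC : #|(B :\: A) :|: C| == k.
  rewrite cardsU (_ : _ :&: _ = set0) ?cards0; first by lia.
  apply/setP=> x; rewrite !inE; have := CR x.
  by case: (x \in C); case: (x \in A); case: (x \in B) => // /(_ isT).
have hD : #|(A :\: B) :|: D| == k.
  rewrite cardsU (_ : _ :&: _ = set0) ?cards0; first by lia.
  apply/setP=> x; rewrite !inE; have := DR x.
  by case: (x \in D); case: (x \in A); case: (x \in B);
     case: (x \in C) => // /(_ isT).
pose A' : kneser_vertex n k := exist _ (B :\: A :|: C) hC.
pose B' : kneser_vertex n k := exist _ (A :\: B :|: D) hD.
exists [:: A'; B'; exist _ B hB]; split=> //=.
rewrite /kneser /=; apply/and4P; split=> //; apply/eqP/setP=> x; rewrite !inE;
  have := DR x; have := CR x; case: (x \in D); case: (x \in A);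
  case: (x \in B); case: (x \in C) => //= h1 h2;
  solve [by have := h1 isT | by have := h2 isT].
Qed.

Definition kneser_star (x : 'I_n) : {set kneser_vertex n k} :=
  [set A : kneser_vertex n k | x \in val A].

Lemma card_kneser_star (x : 'I_n) : 0 < k ->
  #|kneser_star x| = 'C(n.-1, k.-1).
Proof.
move=> k0; rewrite -(card_imset _ val_inj).
have cx : #|~: [set x]| = n.-1 by rewrite cardsC1 card_ord.
rewrite -cx -cards_draws.
set D := [set _ | _]; rewrite -(@card_in_imset _ _ (fun B => x |: B) D).
  apply: eq_card => A; apply/imsetP/imsetP => -[].
    move=> A' xA' ->; rewrite inE in xA'; exists (val A' :\ x); last first.
      by rewrite setD1K.
    have := cardsD1 x (val A'); rewrite xA' (eqP (valP A')) inE => c.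
    apply/andP; split; last by apply/eqP; rewrite [RHS](congr1 predn c).
    by apply/subsetP => y; rewrite !inE => /andP[].
  move=> B; rewrite inE subsetC sub1set inE => /andP[xB /eqP cB] ->.
  have hB : #|x |: B| == k by rewrite cardsU1 xB cB; lia.
  by exists (exist _ (x |: B) hB); rewrite // inE /= setU11.
move=> B C; rewrite !inE !(subsetC _ [set x]) !sub1set !inE.
by move=> /andP[xB _] /andP[xC _] /(congr1 (fun E => E :\ x)); rewrite !setU1K.
Qed.

End Kneser.

Theorem proposition6 (n k : nat) (hk : 2 <= k)
  (hlow : 5 * k - 1 <= 2 * n) (hup : n <= 7 * k - 5) :
  'C(n.-1, k.-1) <= mutual_visibility_number (kneser n k).
Proof.
have n0 : 0 < n by lia.
pose x := Ordinal n0.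
rewrite -(@card_kneser_star n k x); last by lia.
have starI : {in kneser_star k x &, forall A B, val A :&: val B != set0}.
  move=> A B; rewrite !inE => xA xB.
  by apply/set0Pn; exists x; rewrite inE xA.
apply: leq_bigmax_cond; apply/asboolP.
apply: independent_diameter3_mutual_visibility => A B AX BX.
  exact: starI.
by apply: kneser_walk3 => //; apply: starI.
Qed.
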